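(* Let $n$ be a positive integer, and let $0<\lambda_1<\cdots<\lambda_n$ and $0<\mu_1<\cdots<\mu_n$ be real numbers such that $\mu_{i+1}-\mu_i$ is a positive integer for all $1\le i\le n-1$. Then, for every positive integer $m$, the $n\times n$ matrices $$\left[(\Gamma(\lambda_i+\mu_j))^m\right]_{i,j=1}^n\quad\text{and}\quad\left[\frac{1}{\beta(\lambda_i,\mu_j)^m}\right]_{i,j=1}^n$$ are totally positive.
   Context: $\Gamma$ is the gamma function and, for $x,y>0$, $\beta(x,y)=\frac{\Gamma(x)\Gamma(y)}{\Gamma(x+y)}$ is the beta function. The powers are entrywise. A matrix is called totally positive if all its minors (determinants of all square submatrices, of every size) are positive. *)

(* Defs.v *)
From mathcomp Require Import all_boot all_order all_algebra.
From mathcomp Require Import all_classical all_reals all_analysis.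

Set Implicit Arguments.
Unset Strict Implicit.
Unset Printing Implicit Defensive.

Import Order.TTheory GRing.Theory Num.Theory.
Local Open Scope classical_set_scope.
Local Open Scope ring_scope.

(* Euler's integral, meaningful for x > 0; for x <= 0 the integral diverges
   and the value is the junk value 0. *)
Definition Gamma (R : realType) (x : R) : R :=
  \int[@lebesgue_measure R]_(t in `]0, +oo[) (t `^ (x - 1) * expR (- t)).

(* The library's [beta_fun] only takes natural number arguments. *)
Definition Beta (R : realType) (x y : R) : R :=
  Gamma x * Gamma y / Gamma (x + y).

Definition totally_positive (R : realType) (p q : nat) (A : 'M[R]_(p, q)) :
    Prop :=
  forall (k : nat) (f : 'I_k -> 'I_p) (g : 'I_k -> 'I_q),
    (0 < k)%N ->
    {homo f : i j / (i < j)%N} -> {homo g : i j / (i < j)%N} ->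
    0 < \det (mxsub f g A).

(* Main.v *)
Require Import Defs.
From mathcomp Require Import all_boot all_order all_algebra.
From mathcomp Require Import all_classical all_reals all_analysis.
From mathcomp Require Import measurable_realfun archimedean perm ring.
Import Order.TTheory GRing.Theory Num.Theory.
Import numFieldNormedType.Exports.

Set Implicit Arguments.
Unset Strict Implicit.
Unset Printing Implicit Defensive.

Local Open Scope classical_set_scope.
Local Open Scope ring_scope.

(* Write mu_j = mu_1 + N_j with N_j a natural number and x_i = lam_i + mu_1.
   Then Gamma(x + N)^m = Gamma(x)^m (x (x+1) ... (x+N-1))^m, and the last factor
   is the Newton polynomial q_{Nm}(x), where q_N(x) = prod_{l < N} (x + a_l) and
   a_l = floor(l / m).  Up to positive row and column factors (also for 1/beta),
   every minor is thus some det [q_{N_j}(x_i)], which is positive for any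
   a_l >= 0, by induction on the size: after factoring out the first column,
   q_N(y) / q_N(x_0) = 1 + (y - x_0) sum_{l < N} q_l(y) / q_{l+1}(x_0), so
   eliminating the first row and taking differences of consecutive columns
   leaves columns that are positive combinations of the q_l with
   N_j <= l < N_{j+1}; by multilinearity the determinant is a nonempty
   positive combination of smaller determinants of the same kind. *)

(** * Determinants under diagonal scaling and under sums in the columns *)

Lemma det_scale (R : comNzRingType) n (r c : 'I_n -> R)
    (A : 'I_n -> 'I_n -> R) :
  \det (\matrix_(i, j) (r i * A i j * c j)) =
  (\prod_i r i) * \det (\matrix_(i, j) A i j) * \prod_j c j.
Proof.
have -> : \matrix_(i, j) (r i * A i j * c j) =
    diag_mx (\row_i r i) *m (\matrix_(i, j) A i j) *m diag_mx (\row_j c j).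
  by apply/matrixP => i j; rewrite mul_mx_diag mul_diag_mx !mxE.
rewrite !det_mulmx !det_diag.
by congr (_ * _ * _); apply: eq_bigr => i _; rewrite mxE.
Qed.

(** Multilinearity in the columns: [f] picks one summand per column. After transposing, the Leibniz
    product runs over the columns, so distributing it over the sums gives the claim. *)
Lemma det_col_sum (R : comNzRingType) n (I : finType) (P : 'I_n -> pred I)
    (F : 'I_n -> I -> R) :
  \det (\matrix_(i, j) \sum_(l | P j l) F i l) =
  \sum_(f in family P) \det (\matrix_(i, j) F i (f j)).
Proof.
under [RHS]eq_bigr => f _ do rewrite -det_tr.
rewrite -det_tr /determinant.
rewrite exchange_big; apply: eq_bigr => s _.
rewrite -mulr_sumr; congr (_ * _).
under eq_bigr => i _ do rewrite !mxE.
rewrite (bigA_distr_big_dep _ (fun i l => F (s i) l)).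
by apply: eq_bigr => f _; apply: eq_bigr => i _; rewrite !mxE.
Qed.

(** * Newton polynomials and the positivity of their determinants *)

Definition newton_poly (R : pzRingType) (a : nat -> R) (N : nat) (x : R) : R :=
  \prod_(0 <= l < N) (x + a l).

Lemma newton_poly_gt0 (R : realFieldType) (a : nat -> R) N x :
  (forall l, 0 <= a l) -> 0 < x -> 0 < newton_poly a N x.
Proof. by move=> a0 x0; apply: prodr_gt0 => l _; rewrite ltr_wpDr. Qed.

Lemma newton_polyD (R : pzRingType) (a : nat -> R) M N x :
  newton_poly a (M + N) x =
  newton_poly a M x * newton_poly (fun l => a (M + l)%N) N x.
Proof.
rewrite /newton_poly (@big_cat_nat _ _ _ M) ?leq_addr//=; congr (_ * _).
rewrite -{1}[M]add0n big_addn addKn.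
by apply: eq_bigr => l _; rewrite addnC.
Qed.

(** Passing from N to N + 1 multiplies the ratio by 1 + (y - x) / (x + a N), and the increment is
    exactly the new term of the sum. *)
Lemma newton_poly_ratio (R : realFieldType) (a : nat -> R) N x y :
  (forall l, 0 <= a l) -> 0 < x ->
  newton_poly a N y / newton_poly a N x =
  1 + (y - x) * \sum_(0 <= l < N) newton_poly a l y / newton_poly a l.+1 x.
Proof.
move=> a0 x0; elim: N => [|N IHN].
  by rewrite /newton_poly !big_geq// mulr0 addr0 divr1.
rewrite big_nat_recr//= mulrDr addrA -IHN.
have := @newton_poly_gt0 _ a N x a0 x0.
have : 0 < x + a N by rewrite ltr_wpDr.
rewrite /newton_poly !(@big_nat_recr _ _ _ N)//= => h1 h2.
by field; rewrite !gt_eqF.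
Qed.

Lemma det_newton_poly_gt0 (R : realFieldType) n (a : nat -> R)
    (x : 'I_n -> R) (N : 'I_n -> nat) :
  (forall l, 0 <= a l) -> (forall i, 0 < x i) ->
  {homo x : i j / (i < j)%N >-> i < j} ->
  {homo N : i j / (i < j)%N} ->
  0 < \det (\matrix_(i, j) newton_poly a (N j) (x i)).
Proof.
elim: n a x N => [|n IHn] a x N a0 x0 xS NS; first by rewrite det_mx00.
(* Dividing by the first column leaves Newton polynomials for the shifted sequence [b]; this is why
   the induction generalizes over [a]. *)
pose b l := a (N ord0 + l)%N.
(* The remaining degrees, indexed by [nat] so that [M k.+1] makes sense; [inord] is faithful only
   for k <= n, hence the bounds below. *)
pose M k := (N (inord k) - N ord0)%N.
have M0 : M 0%N = 0%N.
  rewrite /M (_ : inord 0 = ord0) ?subnn//.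
  by apply: val_inj; rewrite /= inordK.
have b0 l : 0 <= b l by exact: a0.
have NE j : N j = (N ord0 + M j)%N.
  rewrite /M inord_val subnKC//.
  by have [->//|j0] := eqVneq j ord0; apply/ltnW/NS; rewrite lt0n.
have MS k : (k < n)%N -> (M k < M k.+1)%N.
  move=> kn; have : (N (inord k) < N (inord k.+1))%N.
    by apply: NS; rewrite !inordK ?ltnS// ltnW.
  by rewrite (NE (inord k)) (NE (inord k.+1)) ltn_add2l !inordK ?ltnS// ltnW.
have ML k l : (k <= l <= n)%N -> (M k <= M l)%N.
  case/andP; elim: l => [|l IHl]; first by rewrite leqn0 => /eqP->.
  rewrite leq_eqVlt => /predU1P[->//|]; rewrite ltnS => kl ln.
  by apply: leq_trans (IHl kl (ltnW ln)) _; exact/ltnW/MS.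
pose Q l := newton_poly b l (x ord0).
have Q0 l : 0 < Q l by exact: newton_poly_gt0.
(* By [newton_poly_ratio], (y - x ord0) * T k y is the difference of the normalized columns k + 1
   and k. *)
pose T k y := \sum_(M k <= l < M k.+1) newton_poly b l y / Q l.+1.
have TE j y : (j <= n)%N ->
    \sum_(0 <= l < M j) newton_poly b l y / Q l.+1 = \sum_(0 <= k < j) T k y.
  elim: j => [|j IHj] jn; first by rewrite M0 !big_geq.
  rewrite big_nat_recr//= -IHj ?(ltnW jn)// /T -big_cat_nat//.
  by apply/ltnW/MS.
have -> : \matrix_(i, j) newton_poly a (N j) (x i) = \matrix_(i, j)
    (newton_poly a (N ord0) (x i) * (newton_poly b (M j) (x i) / Q (M j)) *
     Q (M j)).
  apply/matrixP => i j; rewrite !mxE {1}NE newton_polyD -!mulrA mulVf ?mulr1//.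
  by rewrite gt_eqF.
rewrite det_scale; apply: mulr_gt0; last by apply: prodr_gt0.
apply: mulr_gt0; first by apply: prodr_gt0 => i _; exact: newton_poly_gt0.
(* [E] holds the column of ones followed by the consecutive differences; the unitriangular [U] sums
   them back up, so [E] has the same determinant as the normalized matrix. *)
pose E := \matrix_(i < n.+1, k < n.+1)
  (if unlift ord0 k is Some k' then (x i - x ord0) * T k' (x i) else 1).
pose U : 'M[R]_n.+1 := \matrix_(k, j) (k <= j)%N%:R.
have -> : \matrix_(i, j) (newton_poly b (M j) (x i) / Q (M j)) = E *m U.
  apply/matrixP => i j; rewrite !mxE newton_poly_ratio// TE ?leq_ord//.
  rewrite big_ord_recl !mxE unlift_none mulr1; congr (_ + _).
  rewrite mulr_sumr (big_nat_widen _ _ n) ?leq_ord// big_mkord big_mkcond/=.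
  apply: eq_bigr => k _; rewrite !mxE liftK /= /bump/= add1n.
  by case: ifP => _; rewrite ?mulr1 ?mulr0.
rewrite det_mulmx -(det_tr U) (@det_trig _ _ U^T); last first.
  by apply/is_trig_mxP => i j ij; rewrite !mxE leqNgt ij.
rewrite big1 ?mulr1; last by move=> i _; rewrite !mxE leqnn.
(* The first row of [E] is (1, 0, ..., 0), as x i - x ord0 vanishes there; only the corner cofactor
   survives. *)
rewrite (expand_det_row _ ord0) big_ord_recl big1 => [|k _]; last first.
  by rewrite mxE liftK subrr !mul0r.
rewrite addr0 mxE unlift_none mul1r /cofactor addn0 expr0 mul1r.
have -> : row' ord0 (col' ord0 E) = \matrix_(i, k)
    ((x (lift ord0 i) - x ord0) * T k (x (lift ord0 i)) * 1).
  by apply/matrixP => i k; rewrite !mxE liftK mulr1.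
rewrite (det_scale (fun i => _ - _) (fun=> 1)
  (fun i k => T k (x (lift ord0 i)))).
rewrite [X in _ * X]big1 // mulr1; apply: mulr_gt0.
  by apply: prodr_gt0 => i _; rewrite subr_gt0; apply: xS.
(* The blocks [P k] are consecutive intervals of degrees, so choosing one degree in each block
   always gives a strictly increasing sequence, to which the induction hypothesis applies. *)
pose P (k : 'I_n) := [pred l : 'I_(M n) | (M k <= l < M k.+1)%N].
have -> : \matrix_(i, k) T k (x (lift ord0 i)) = \matrix_(i < n, k < n)
    \sum_(l | P k l) newton_poly b l (x (lift ord0 i)) / Q l.+1.
  apply/matrixP => i k; rewrite !mxE /T (big_nat_widen _ _ (M n)).
    by rewrite (big_nat_widenl _ 0)//= big_mkord; apply: eq_bigl => l;
      rewrite /= andbC.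
  by apply: ML; rewrite ltn_ord/=.
rewrite (det_col_sum P (fun i l => newton_poly b l (x (lift ord0 i)) / Q l.+1)).
have fam_gt0 (f : {ffun 'I_n -> 'I_(M n)}) : f \in family P ->
    0 < \det (\matrix_(i, j)
      (newton_poly b (f j) (x (lift ord0 i)) / Q (f j).+1)).
  move=> /familyP fP.
  have -> :
      \matrix_(i, j) (newton_poly b (f j) (x (lift ord0 i)) / Q (f j).+1) =
      \matrix_(i, j)
        (1 * newton_poly b (f j) (x (lift ord0 i)) * (Q (f j).+1)^-1).
    by apply/matrixP => i j; rewrite !mxE mul1r.
  rewrite (det_scale (fun=> 1) (fun j => (Q (f j).+1)^-1)
    (fun i j => newton_poly b (f j) (x (lift ord0 i)))).
  rewrite big1// mul1r; apply: mulr_gt0; last first.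
    by apply: prodr_gt0 => j _; rewrite invr_gt0.
  apply: (IHn b (x \o lift ord0) (fun j => f j : nat)) => //.
  - by move=> i /=.
  - by move=> i j ij /=; apply: xS.
  - move=> i j ij; have := fP i; have := fP j.
    rewrite !inE => /andP[fj _] /andP[_ fi].
    by apply: leq_trans fi (leq_trans _ fj); apply: ML; rewrite ij ltnW.
have f0M (k : 'I_n) : (M k < M n)%N.
  by apply: leq_trans (MS k (ltn_ord k)) _; apply: ML; rewrite ltn_ord/=.
(* The choice of the left end of every block, which lies in the block by [MS], shows that the sum
   has at least one term and is thus strictly positive. *)
pose f0 : {ffun 'I_n -> 'I_(M n)} := [ffun k => Ordinal (f0M k)].
have f0P : f0 \in family P.
  by apply/familyP => k; rewrite ffunE inE/= leqnn MS.
rewrite (bigD1 f0)//= ltr_wpDr ?fam_gt0//.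
by apply: sumr_ge0 => f /andP[fP _]; exact/ltW/fam_gt0.
Qed.

(** * The integrand of the gamma function and integration by parts *)

Definition powR_expRN (R : realType) (x t : R) : R := t `^ x * expR (- t).

Lemma powR_expRN_ge0 (R : realType) (x t : R) : 0 <= powR_expRN x t.
Proof. by rewrite mulr_ge0 ?powR_ge0 ?expR_ge0. Qed.

Lemma is_derive_powR_expRN (R : realType) (x t : R) : 0 < t ->
  is_derive t (1 : R) (powR_expRN x)
    (x * powR_expRN (x - 1) t - powR_expRN x t).
Proof.
move=> t0; have dp := is_derive1_powR x t0.
have de : is_derive t (1 : R) (fun t : R => expR (- t)) (expR (- t) * - 1).
  by apply: (@is_derive1_comp _ (@expR R) (@GRing.opp R)).
apply: is_derive_eq.
by rewrite /powR_expRN /GRing.scale/=; ring.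
Qed.

Lemma derivable_powR_expRN (R : realType) (x t : R) :
  0 < t -> derivable (powR_expRN x) t (1 : R).
Proof. by move=> t0; have [] := is_derive_powR_expRN x t0. Qed.

Lemma continuous_powR_expRN (R : realType) (x t : R) :
  0 < t -> {for t, continuous (powR_expRN x)}.
Proof.
move=> t0.
by apply/differentiable_continuous/derivable1_diffP/derivable_powR_expRN.
Qed.

Lemma within_continuous_powR_expRN (R : realType) (x a b : R) : 0 < a ->
  {within `[a, b], continuous (powR_expRN x)}.
Proof.
move=> a0; apply: derivable_within_continuous => t.
rewrite in_itv/= => /andP[at0 _].
by apply: derivable_powR_expRN; exact: lt_le_trans at0.
Qed.

Lemma measurable_powR_expRN (R : realType) (x : R) :
  measurable_fun (`]0, +oo[%classic : set R) (powR_expRN x).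
Proof.
apply: open_continuous_measurable_fun => // t.
by rewrite inE/= in_itv/= andbT => t0; exact: continuous_powR_expRN.
Qed.

Lemma integrable_powR_expRN (R : realType) (x a b : R) : 0 < a ->
  (@lebesgue_measure R).-integrable `[a, b] (EFin \o powR_expRN x).
Proof.
move=> a0; apply: continuous_compact_integrable; first exact: segment_compact.
exact: within_continuous_powR_expRN.
Qed.

(** The fundamental theorem of calculus for [powR_expRN x]. Any real x is allowed: x = 0 later
    computes the integral of exp(-t). *)
Lemma powR_expRN_by_parts (R : realType) (x a b : R) : 0 < a -> a < b ->
  x * \int[@lebesgue_measure R]_(t in `[a, b]) powR_expRN (x - 1) t =
  \int[@lebesgue_measure R]_(t in `[a, b]) powR_expRN x t +
  (powR_expRN x b - powR_expRN x a).
Proof.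
move=> a0 ab; have b0 := lt_trans a0 ab.
have int1 : (@lebesgue_measure R).-integrable `[a, b]
    (EFin \o (fun t => x * powR_expRN (x - 1) t)).
  apply: continuous_compact_integrable; first exact: segment_compact.
  move=> t; apply: cvgM; [exact: cvg_cst|exact: within_continuous_powR_expRN].
rewrite -RintegralZl//; last exact: integrable_powR_expRN.
apply/eqP; rewrite [eqbRHS]addrC -subr_eq -RintegralB//; last first.
  exact: integrable_powR_expRN.
rewrite /Rintegral (@continuous_FTC2 _ _ (powR_expRN x))//.
- move=> t; apply: cvgB; last exact: within_continuous_powR_expRN.
  by apply: cvgM; [exact: cvg_cst|exact: within_continuous_powR_expRN].
- split.
  + move=> t; rewrite in_itv/= => /andP[at0 _].
    by apply: derivable_powR_expRN; exact: lt_trans at0.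
  + by apply: cvg_at_right_filter; exact: continuous_powR_expRN.
  + by apply: cvg_at_left_filter; exact: continuous_powR_expRN.
- move=> t; rewrite in_itv/= => /andP[at0 _].
  have t0 := lt_trans a0 at0.
  by rewrite derive1E; have [_ ->] := is_derive_powR_expRN x t0.
Qed.

(** * Recursion, finiteness and positivity of the gamma function *)

Definition gamma_integral (R : realType) (x : R) : \bar R :=
  (\int[@lebesgue_measure R]_(t in `]0%R, +oo[) (powR_expRN (x - 1) t)%:E)%E.

(** Since [fine] sends an infinite value to 0, the recursion and the finiteness are first proved for
    the extended real integral. *)
Lemma GammaE (R : realType) (x : R) : Gamma x = fine (gamma_integral x).
Proof. by []. Qed.

Lemma bigcup_itv_harmonic (R : realType) :
  \bigcup_n `[n.+1%:R^-1, n.+2%:R]%classic = `]0, +oo[%classic :> set R.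
Proof.
apply/seteqP; split => t /=.
  by move=> [n _]/=; rewrite !in_itv/= andbT => /andP[+ _]; apply: lt_le_trans.
rewrite in_itv/= andbT => t0.
(* With this choice n + 1 exceeds both t and 1 / t. *)
pose n := maxn (Num.truncn t) (Num.truncn t^-1); exists n => //=.
rewrite in_itv/=; apply/andP; split.
  rewrite -[leRHS]invrK lef_pV2 ?posrE ?invr_gt0//.
  apply: le_trans (ltW (truncnS_gt _)) _.
  by rewrite ler_nat ltnS leq_maxr.
apply: le_trans (ltW (truncnS_gt _)) _.
by rewrite ler_nat ltnS ltnW// ltnS leq_maxl.
Qed.

(** Monotone convergence along compact intervals exhausting the half-line; they avoid 0, so the
    integrals over them are finite for every real x. *)
Lemma cvg_gamma_integral (R : realType) (x : R) :
  (\int[@lebesgue_measure R]_(t in `[n.+1%:R^-1, n.+2%:R])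
     powR_expRN (x - 1) t)%:E @[n --> \oo] --> gamma_integral x.
Proof.
rewrite /gamma_integral -bigcup_itv_harmonic.
have -> : (fun n : nat =>
    (\int[@lebesgue_measure R]_(t in `[n.+1%:R^-1, n.+2%:R])
     powR_expRN (x - 1) t)%:E) = (fun n : nat =>
    \int[@lebesgue_measure R]_(t in `[n.+1%:R^-1%R, n.+2%:R%R])
     (powR_expRN (x - 1) t)%:E)%E.
  apply/funext => n; rewrite /Rintegral fineK//.
  by apply: integrable_fin_num => //; apply: integrable_powR_expRN.
apply: ge0_nondecreasing_set_cvg_integral => //.
- move=> m n mn; apply/subsetPset => t /=; rewrite !in_itv/= => /andP[t1 t2].
  apply/andP; split.
    by apply: le_trans t1; rewrite lef_pV2 ?posrE// ler_nat ltnS.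
  by apply: le_trans t2 _; rewrite ler_nat !ltnS.
- move=> n; apply: (measurable_int (@lebesgue_measure R)).
  exact: integrable_powR_expRN.
- by move=> n t _; rewrite lee_fin powR_expRN_ge0.
Qed.

(** From exp(s) >= s: s = t / (2 * x) raised to the power x bounds t^x by (2 * x)^x * exp(t / 2),
    and s = t / 2 turns the remaining exp(- t / 2) into the decay 2 / t. *)
Lemma powR_expRN_le (R : realType) (x t : R) : 0 < x -> 0 < t ->
  powR_expRN x t <= (2 * x) `^ x * 2 / t.
Proof.
move=> x0 t0; have x20 : 0 < 2 * x by rewrite mulr_gt0.
have tx : t `^ x <= (2 * x) `^ x * expR (t / 2).
  have -> : expR (t / 2) = expR (t / (2 * x)) `^ x.
    by rewrite -expRM; congr expR; field; rewrite gt_eqF.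
  rewrite -powRM ?(ltW x20) ?expR_ge0//.
  apply: ge0_ler_powR; rewrite ?nnegrE ?(ltW x0) ?(ltW t0)//.
    by rewrite mulr_ge0 ?expR_ge0 ?ltW.
  rewrite mulrC -ler_pdivrMr//.
  by apply: le_trans (expR_ge1Dx _); rewrite ler_wpDl.
have e2 : expR (- (t / 2)) <= 2 / t.
  rewrite expRN -[leRHS]invrK lef_pV2 ?posrE ?expR_gt0 ?invr_gt0 ?divr_gt0//.
  by rewrite invf_div; apply: le_trans (expR_ge1Dx _); rewrite ler_wpDl.
rewrite /powR_expRN; have -> : - t = - (t / 2) + - (t / 2) by field.
rewrite expRD mulrA -mulrA; apply: le_trans (ler_wpM2r _ tx) _.
  by rewrite mulr_ge0// expR_ge0.
rewrite -!mulrA ler_wpM2l ?powR_ge0// mulrA expRN mulfV ?mul1r -?expRN//.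
by rewrite gt_eqF// expR_gt0.
Qed.

Lemma cvg_powR_expRN_pinfty (R : realType) (x : R) : 0 < x ->
  powR_expRN x n.+2%:R @[n --> \oo] --> 0.
Proof.
move=> x0; apply: (@squeeze_cvgr _ _ _ _ (cst 0)
  (fun n => (2 * x) `^ x * 2 * harmonic n)); last 2 first.
- exact: cvg_cst.
- rewrite -[X in _ --> X](mulr0 ((2 * x) `^ x * 2)).
  by apply: cvgM; [exact: cvg_cst|exact: cvg_harmonic].
apply: nearW => n; rewrite powR_expRN_ge0/=.
apply: le_trans (powR_expRN_le _ _) _ => //.
rewrite ler_wpM2l//= ?mulr_ge0 ?powR_ge0// /harmonic/=.
by rewrite lef_pV2 ?posrE// ler_nat.
Qed.

Lemma cvg_powR_expRN_0 (R : realType) (x : R) : 0 < x ->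
  powR_expRN x n.+1%:R^-1 @[n --> \oo] --> 0.
Proof.
move=> x0; apply: (@squeeze_cvgr _ _ _ _ (cst 0)
  (fun n => n.+1%:R^-1 `^ x)); last 2 first.
- exact: cvg_cst.
- have /cvg_at_rightP := powR_cvg0 x0.
  by apply; split => //; exact: cvg_harmonic.
apply: nearW => n; rewrite powR_expRN_ge0/= ler_piMr ?powR_ge0//.
Qed.

(** Integrate by parts on [1 / (n + 1), n + 2] and let n grow: the boundary terms tend to 0.
    Finiteness of the integrals is not presupposed, since adding the finite limit 0 is always
    defined. *)
Lemma gamma_integralS (R : realType) (x : R) : 0 < x ->
  gamma_integral (x + 1) = (x%:E * gamma_integral x)%E.
Proof.
move=> x0; rewrite -[LHS]adde0.
have := cvgeZl (isT : x%:E \is a fin_num) (@cvg_gamma_integral R x).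
have : (powR_expRN x n.+2%:R - powR_expRN x n.+1%:R^-1)%:E @[n --> \oo] --> 0%E.
  apply: cvg_EFin; first exact: nearW.
  rewrite -[X in _ --> X](subrr 0); apply: cvgB.
    exact: cvg_powR_expRN_pinfty.
  exact: cvg_powR_expRN_0.
have adef : (gamma_integral (x + 1) +? 0)%E by exact: fin_num_adde_defl.
move=> h1; have := cvgeD adef (@cvg_gamma_integral R (x + 1)) h1 => {h1}.
have -> : (fun n : nat =>
    (\int[@lebesgue_measure R]_(t in `[n.+1%:R^-1, n.+2%:R])
     powR_expRN (x + 1 - 1) t)%:E +
     (powR_expRN x n.+2%:R - powR_expRN x n.+1%:R^-1)%:E)%E =
  (fun n : nat => x%:E *
    (\int[@lebesgue_measure R]_(t in `[n.+1%:R^-1, n.+2%:R])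
     powR_expRN (x - 1) t)%:E)%E.
  apply/funext => n; rewrite -EFinM powR_expRN_by_parts// ?addrK ?EFinD//.
  rewrite (@le_lt_trans _ _ 1) ?ltr1n// invf_le1// ler1n//.
by move=> h1 h2; exact: cvg_unique (h1 _) h2.
Qed.

(** Over [a, b] with 0 < a < b the integral is exp(-a) - exp(-b), which is at most 1. *)
Lemma gamma_integral1 (R : realType) : (gamma_integral (1 : R) <= 1)%E.
Proof.
apply: (cvge_to_le (@cvg_gamma_integral R 1)); apply: nearW => n.
have := @powR_expRN_by_parts R 0 n.+1%:R^-1 n.+2%:R.
rewrite mul0r subrr => /(_ _ _)/eqP.
rewrite eq_sym addr_eq0 => /(_ _ _)/eqP -> //; last first.
  by rewrite (@le_lt_trans _ _ 1) ?ltr1n// invf_le1// ler1n.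
rewrite lee_fin opprB /powR_expRN !powRr0 !mul1r.
apply: (@le_trans _ _ (expR (- n.+1%:R^-1))); first by rewrite gerBl expR_ge0.
by rewrite -expR0 ler_expR oppr_le0 invr_ge0.
Qed.

Lemma gamma_integral_ge0 (R : realType) (x : R) : (0 <= gamma_integral x)%E.
Proof. by apply: integral_ge0 => t _; rewrite lee_fin powR_expRN_ge0. Qed.

(* The recursion gives positive integers from x = 1, the bound
   t^(y-1) <= 1 + t^floor(y) then gives y >= 1, and the recursion read backwards
   gives 0 < x < 1. *)
Lemma gamma_integral_lty (R : realType) (x : R) :
  0 < x -> (gamma_integral x < +oo)%E.
Proof.
have Gnat n : (gamma_integral (n.+1%:R : R) < +oo)%E.
  elim: n => [|n IHn]; first exact: le_lt_trans (gamma_integral1 R) (ltry _).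
  rewrite -natr1 gamma_integralS//; apply: lte_mul_pinfty => //.
have Gge1 (y : R) : 1 <= y -> (gamma_integral y < +oo)%E.
  move=> y1; set n := Num.truncn y.
  suff : (gamma_integral y <= gamma_integral (1 : R) +
      gamma_integral (n.+1%:R : R))%E.
    by move/le_lt_trans; apply; exact: lte_add_pinfty (Gnat 0%N) (Gnat n).
  have mE z : measurable_fun (`]0, +oo[%classic : set R)
      (fun t => (powR_expRN z t)%:E).
    by apply/measurable_EFinP; exact: measurable_powR_expRN.
  rewrite /gamma_integral -ge0_integralD//=; last 4 first.
  - by move=> t _; rewrite lee_fin powR_expRN_ge0.
  - exact: mE.
  - by move=> t _; rewrite lee_fin powR_expRN_ge0.
  - exact: mE.
  apply: ge0_le_integral => //=.
  - by move=> t _; rewrite lee_fin powR_expRN_ge0.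
  - exact: mE.
  - by apply: emeasurable_funD; exact: mE.
  move=> t; rewrite in_itv/= andbT => t0.
  rewrite -EFinD lee_fin /powR_expRN -mulrDl ler_wpM2r ?expR_ge0//.
  have [t1|/ltW t1] := leP t 1.
    rewrite ler_wpDr ?powR_ge0//; apply: ger_powR; first by rewrite t0.
    by rewrite lerB.
  rewrite ler_wpDl ?powR_ge0//; apply: ler_powR => //.
  by rewrite lerB// ltW// truncnS_gt.
move=> x0; have := Gge1 (x + 1).
rewrite lerDr gamma_integralS// => /(_ (ltW x0)).
have := gamma_integral_ge0 x; case: (gamma_integral x) => // [r _ _|].
  exact: ltry.
by rewrite gt0_muley.
Qed.

Lemma GammaS (R : realType) (x : R) : 0 < x -> Gamma (x + 1) = x * Gamma x.
Proof.
move=> x0; rewrite !GammaE gamma_integralS// fineM//.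
by rewrite ge0_fin_numE ?gamma_integral_lty ?gamma_integral_ge0.
Qed.

(** By the recursion it is enough to treat x + 1, where the exponent x is positive and the integrand
    is at least exp(-2) on [1, 2]. *)
Lemma Gamma_gt0 (R : realType) (x : R) : 0 < x -> 0 < Gamma x.
Proof.
move=> x0; rewrite -(pmulr_rgt0 _ x0) -GammaS// GammaE.
have x10 : 0 < x + 1 by rewrite addr_gt0.
rewrite fine_gt0// gamma_integral_lty// andbT.
apply: (@lt_le_trans _ _ (\int[@lebesgue_measure R]_(t in `[1%R, 2%R])
  cst (expR (- 2))%:E t)%E).
  rewrite integral_cst//= lebesgue_measure_itv/= lte_fin ltr1n/=.
  by rewrite -EFinD -EFinM lte_fin mulr_gt0 ?expR_gt0// subr_gt0 ltr1n.
apply: (@le_trans _ _ (\int[@lebesgue_measure R]_(t in `[1%R, 2%R])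
  (powR_expRN (x + 1 - 1) t)%:E)%E).
  apply: ge0_le_integral => //=.
  - have /measurable_int := @integrable_powR_expRN R (x + 1 - 1) 1 2 ltr01.
    exact.
  move=> t; rewrite in_itv/= => /andP[t1 t2]; rewrite lee_fin /powR_expRN addrK.
  rewrite -[leLHS]mul1r; apply: ler_pM; rewrite ?expR_ge0//.
    by rewrite -(powRr0 t); apply: ler_powR => //; exact: ltW.
  by rewrite ler_expR lerN2.
apply: ge0_subset_integral => //=.
- by apply/measurable_EFinP; exact: measurable_powR_expRN.
- by move=> t _; rewrite lee_fin powR_expRN_ge0.
- by move=> t /=; rewrite !in_itv/= andbT => /andP[+ _]; exact: lt_le_trans.
Qed.

(** * Minors of powers of gamma values and the passage to the beta function *)

Lemma newton_poly_exp (R : comPzRingType) (a : nat -> R) (m N : nat) (x : R) :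
  (0 < m)%N ->
  newton_poly (fun l => a (l %/ m)%N) (N * m) x = newton_poly a N x ^+ m.
Proof.
move=> m0; elim: N => [|N IHN].
  by rewrite mul0n /newton_poly !big_geq// expr1n.
rewrite mulSnr newton_polyD IHN /newton_poly [in RHS]big_nat_recr//= exprMn.
(* The last m indices N * m + l, with l < m, all have quotient N by m. *)
congr (_ * _); rewrite big_mkord (eq_bigr (fun=> x + a N)) => [|l _].
  by rewrite prodr_const card_ord.
by rewrite divnMDl// divn_small// addn0.
Qed.

Lemma GammaDn (R : realType) (x : R) (N : nat) : 0 < x ->
  Gamma (x + N%:R) = Gamma x * newton_poly (fun l => l%:R) N x.
Proof.
move=> x0; elim: N => [|N IHN].
  by rewrite addr0 /newton_poly big_geq// mulr1.
rewrite -natr1 addrA GammaS ?ltr_wpDr// IHN /newton_poly big_nat_recr//=.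
by ring.
Qed.

Lemma det_Gamma_gt0 (R : realType) k (m : nat) (x : 'I_k -> R)
    (N : 'I_k -> nat) :
  (0 < m)%N -> (forall i, 0 < x i) ->
  {homo x : i j / (i < j)%N >-> i < j} -> {homo N : i j / (i < j)%N} ->
  0 < \det (\matrix_(i, j) Gamma (x i + (N j)%:R) ^+ m).
Proof.
move=> m0 x0 xS NS.
pose a l : R := (l %/ m)%:R.
have -> : \matrix_(i, j) Gamma (x i + (N j)%:R) ^+ m = \matrix_(i, j)
    (Gamma (x i) ^+ m * newton_poly a (N j * m) (x i) * 1).
  apply/matrixP => i j; rewrite !mxE GammaDn// exprMn mulr1.
  by rewrite -newton_poly_exp.
rewrite (det_scale (fun i => Gamma (x i) ^+ m) (fun=> 1)
  (fun i j => newton_poly a (N j * m) (x i))).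
rewrite [X in _ * X]big1// mulr1; apply: mulr_gt0.
  by apply: prodr_gt0 => i _; rewrite exprn_gt0// Gamma_gt0.
apply: (@det_newton_poly_gt0 _ _ a x (fun j => N j * m)%N) => //.
by move=> i j ij; rewrite ltn_pmul2r// NS.
Qed.

(** Scaling multiplies each minor by positive factors. This links the two matrices of the theorem,
    whose entries differ by factors depending on the row or the column alone. *)
Lemma totally_positive_scale (R : realType) p q (r : 'I_p -> R) (c : 'I_q -> R)
    (A : 'I_p -> 'I_q -> R) :
  (forall i, 0 < r i) -> (forall j, 0 < c j) ->
  totally_positive (\matrix_(i, j) A i j) ->
  totally_positive (\matrix_(i, j) (r i * A i j * c j)).
Proof.
move=> r0 c0 AP k f g k0 fS gS; have := AP k f g k0 fS gS.
have -> : mxsub f g (\matrix_(i, j) A i j) = \matrix_(i, j) A (f i) (g j).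
  by apply/matrixP => i j; rewrite !mxE.
have -> : mxsub f g (\matrix_(i, j) (r i * A i j * c j)) =
    \matrix_(i, j) (r (f i) * A (f i) (g j) * c (g j)).
  by apply/matrixP => i j; rewrite !mxE.
rewrite (det_scale (r \o f) (c \o g) (fun i j => A (f i) (g j))) => detA.
apply: mulr_gt0; last by apply: prodr_gt0 => j _; exact: c0.
by apply: mulr_gt0 => //; apply: prodr_gt0 => i _; exact: r0.
Qed.

Theorem theorem3p4 (R : realType) (n : nat) (hn : (0 < n)%N)
    (lam mu : 'I_n -> R)
    (lam_gt0 : forall i : 'I_n, 0 < lam i)
    (lam_incr : forall i j : 'I_n, (i < j)%N -> lam i < lam j)
    (mu_gt0 : forall i : 'I_n, 0 < mu i)
    (mu_incr : forall i j : 'I_n, (i < j)%N -> mu i < mu j)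
    (mu_gap : forall i j : 'I_n, nat_of_ord j = (nat_of_ord i).+1 ->
       exists d : nat, (0 < d)%N /\ mu j - mu i = d%:R)
    (m : nat) (hm : (0 < m)%N) :
  totally_positive (\matrix_(i < n, j < n) (Gamma (lam i + mu j) ^+ m)) /\
  totally_positive (\matrix_(i < n, j < n) (1 / Beta (lam i) (mu j) ^+ m)).
Proof.
have GP : totally_positive (\matrix_(i, j) Gamma (lam i + mu j) ^+ m).
  pose i0 := Ordinal hn.
  have [N NE] : {N : 'I_n -> nat | forall j, mu j = mu i0 + (N j)%:R}.
    (* The gaps add up to a natural number, by induction on the index, and truncation reads it
       off. *)
    exists (fun j => Num.truncn (mu j - mu i0)) => -[j jn].
    suff /natrP[d jd] : mu (Ordinal jn) - mu i0 \is a Num.nat.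
      by rewrite jd natrK -jd addrC subrK.
    elim: j jn => [|j IHj] jn.
      by rewrite (_ : Ordinal jn = i0) ?subrr//; exact: val_inj.
    have [d [_ jd]] := mu_gap (Ordinal (ltnW jn)) (Ordinal jn) erefl.
    rewrite -(subrKA (mu (Ordinal (ltnW jn)))) jd.
    by apply: rpredD => //; exact: natr_nat.
  move=> k f g k0 fS gS.
  have -> : mxsub f g (\matrix_(i, j) Gamma (lam i + mu j) ^+ m) =
      \matrix_(i, j) Gamma (lam (f i) + mu i0 + (N (g j))%:R) ^+ m.
    by apply/matrixP => i j; rewrite !mxE (NE (g j)) addrA.
  apply: (@det_Gamma_gt0 _ _ m (fun i => lam (f i) + mu i0) (N \o g)) => //.
  - by move=> i; rewrite addr_gt0.
  - by move=> i j ij; rewrite ltrD2r; apply/lam_incr/fS.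
  (* Strict growth of [N] is inherited from that of [mu] by comparing in [R]. *)
  - move=> i j ij /=; rewrite -(ltr_nat R) -(ltrD2l (mu i0)) -!NE.
    exact/mu_incr/gS.
split=> //.
have -> : \matrix_(i, j) (1 / Beta (lam i) (mu j) ^+ m) = \matrix_(i, j)
    ((Gamma (lam i) ^- m) * Gamma (lam i + mu j) ^+ m * (Gamma (mu j) ^- m)).
  apply/matrixP => i j; rewrite !mxE /Beta expr_div_n exprMn div1r invf_div.
  by rewrite invfM mulrA [_ * Gamma (lam i) ^- m]mulrC.
apply: totally_positive_scale => // i;
  by rewrite invr_gt0 exprn_gt0// Gamma_gt0.
Qed.
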